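(* For every (finite) $3$-graph $H$ there exists a constant $C_H>0$ such that for every $n\in\mathbb{N}$, every $3$-graph $G$ on $n$ vertices with at least $C_H\, n^{3-1/5}$ edges contains a homeomorph of $H$.
   Context: A $3$-graph is a $3$-uniform hypergraph; it is viewed as a two-dimensional simplicial complex (its geometric realization) by identifying each edge $\{x,y,z\}$ with a triangle (2-simplex) on vertices $x,y,z$, glued along shared vertices and shared pairs. Two $3$-graphs are homeomorphic if their geometric realizations are homeomorphic as topological spaces. A $3$-graph $G$ contains a homeomorph of $H$ if some subgraph of $G$ (a subset of its edges, with the vertices they span) is homeomorphic to $H$. *)

(* Defs.v *)
From HB Require Import structures.
From mathcomp Require Import all_boot all_order all_algebra.
From mathcomp Require Import all_classical all_reals all_analysis.
Set Implicit Arguments. Unset Strict Implicit. Unset Printing Implicit Defensive.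
Import Order.TTheory GRing.Theory Num.Theory.
Import numFieldNormedType.Exports.
Local Open Scope classical_set_scope.
Local Open Scope ring_scope.

Definition uniform3 (n : nat) (E : {set {set 'I_n}}) : Prop :=
  forall e, e \in E -> #|e| = 3%N.

(* Geometric realization inside the standard simplex of R^n: vertex i is the
   i-th standard basis vector; an edge e is the (closed) convex hull of its
   three vertices, i.e. points of the simplex supported on e. *)
Definition realization (R : realType) (n : nat) (E : {set {set 'I_n}})
  : set 'rV[R]_n :=
  [set x | (forall i, 0 <= x ord0 i) /\ (\sum_i x ord0 i = 1) /\
           exists2 e, e \in E & forall i, i \notin e -> x ord0 i = 0].

Definition homeomorphic_sets (R : realType) (m n : nat)
  (A : set 'rV[R]_m) (B : set 'rV[R]_n) : Prop :=
  exists (f : 'rV[R]_m -> 'rV[R]_n) (g : 'rV[R]_n -> 'rV[R]_m),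
    {within A, continuous f} /\ {within B, continuous g} /\
    (forall x, A x -> B (f x)) /\ (forall y, B y -> A (g y)) /\
    (forall x, A x -> g (f x) = x) /\ (forall y, B y -> f (g y) = y).

Definition contains_homeomorph (R : realType) (n h : nat)
  (G : {set {set 'I_n}}) (H : {set {set 'I_h}}) : Prop :=
  exists2 F : {set {set 'I_n}}, F \subset G &
    homeomorphic_sets (@realization R h H) (@realization R n F).

(* Main.v *)
(** Every face T = {i,j,k} of H is divided by a centre c_T, a midpoint m_e of
    each edge e, and an apex w_{T,e} inside each quadrilateral
    i, m_{ij}, j, c_T.  To find this in a dense G, call g v b w the relation
    {v,b,w} in G.  Its average degree D in v satisfies D^5 >= K n^4.  For
    random w0 and b0, let U be the set of v with g v b0 w0; it has about D
    elements.  A pair or a triple of vertices with a small common neighbourhood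
    in the link graph of w0 is unlikely to lie in U, because b0 would have to
    fall in that neighbourhood.  Quadrilaterals v1 m v2 c with fewer than q
    apexes number at most q n^5 over all w0 and all third vertices v3, so for
    most triples in U they form a small proportion of the pairs (m, c) of
    common neighbours; comparing with D^3 n^2 is where the exponent 1/5 comes
    from.  The vertices of H are then placed in U with no bad triple among
    them, and the midpoints, centres and apexes are chosen greedily.

    The realizations are homeomorphic because the division is obtained by
    three rounds of stellar subdivision: at the faces, at the edges, and at
    the segments from c_T to m_e. *)
Require Import Defs.
From HB Require Import structures.
From mathcomp Require Import all_boot all_order all_algebra.
From mathcomp Require Import lra ring zify.
Import Order.TTheory GRing.Theory Num.Theory.
Local Open Scope ring_scope.
Set Implicit Arguments. Unset Strict Implicit. Unset Printing Implicit Defensive.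

(** * Stellar subdivision *)

(** The realization with points as plain functions on any finite vertex type, so that a subdivision
    may add vertices by a sum type. Listing the facets suffices, since a point may vanish on part of
    [A]. *)
Definition polyhedron (R : realFieldType) (V : finType) (K : {set {set V}}) (x : V -> R) : Prop :=
  (forall i, 0 <= x i) /\ \sum_i x i = 1 /\
  exists2 A, A \in K & forall i, i \notin A -> x i = 0.

(* The default 1 is harmless: coordinates of points of a realization are at most 1. *)
Definition min_on (R : realFieldType) (V : finType) (s : {set V}) (x : V -> R) : R :=
  \big[Num.min/1]_(i in s) x i.

(** Only facets are listed: the cones from the new vertex [inr j] over [A] minus one vertex of
    [s j]. A facet containing no [s j] would be lost, and one containing two would be covered twice;
    [sK] and [sU] below exclude both. *)
Definition star_complex (V J : finType) (P : {pred J}) (s : J -> {set V}) (K : {set {set V}}) :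
    {set {set (V + J)%type}} :=
  [set B | [exists A in K, exists j in P, exists i in s j,
     (s j \subset A) && (B == inr j |: [set inl v | v in A :\ i])]].

(* Removing the minimum of x over s j from all coordinates in s j, for every j,
   leaves the barycentric coordinates with respect to the subdivision: at a
   point of the realization only one j contributes. *)
Definition star (R : realFieldType) (V J : finType) (P : {pred J}) (s : J -> {set V})
    (x : V -> R) (l : V + J) : R :=
  match l with
  | inl i => x i - \sum_(j in P | i \in s j) min_on (s j) x
  | inr j => if j \in P then #|s j|%:R * min_on (s j) x else 0
  end.

(** The linear map that sends the new vertex [inr j] to the barycentre of [s j]. *)
Definition unstar (R : realFieldType) (V J : finType) (P : {pred J}) (s : J -> {set V})
    (y : V + J -> R) (i : V) : R :=
  y (inl i) + \sum_(j in P | i \in s j) y (inr j) / #|s j|%:R.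

Lemma polyhedron_le1 (R : realFieldType) (V : finType) (K : {set {set V}}) (x : V -> R) i :
  polyhedron K x -> x i <= 1.
Proof.
move=> [x0 [<- _]]; rewrite (bigD1 i) //= lerDl; exact: sumr_ge0.
Qed.

Lemma min_on_ge0 (R : realFieldType) (V : finType) (s : {set V}) (x : V -> R) :
  (forall i, 0 <= x i) -> 0 <= min_on s x.
Proof. by move=> x0; apply/bigmin_geP; split. Qed.

Lemma min_on_le (R : realFieldType) (V : finType) (s : {set V}) (x : V -> R) i :
  i \in s -> min_on s x <= x i.
Proof. by move=> si; apply: bigmin_le_cond. Qed.

Lemma min_on_eq (R : realFieldType) (V : finType) (s : {set V}) (x : V -> R) i :
  i \in s -> (forall j, j \in s -> x i <= x j) -> x i <= 1 -> min_on s x = x i.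
Proof.
move=> si xi x1; apply/eqP; rewrite eq_le min_on_le //=.
by apply/bigmin_geP; split.
Qed.

(** True at every point, not only on the realization: [unstar] adds back exactly the minima that
    [star] removed. *)
Lemma starK (R : realFieldType) (V J : finType) (P : {pred J}) (s : J -> {set V}) (x : V -> R) :
  (forall j, j \in P -> s j != set0) -> unstar P s (star P s x) =1 x.
Proof.
move=> s0 i; rewrite /unstar /star.
rewrite [X in _ + X](eq_bigr (fun j => min_on (s j) x)) ?subrK // => j /andP[Pj sj].
by rewrite Pj mulrC mulKf // pnatr_eq0 cards_eq0 s0.
Qed.

Section Star.
Variables (R : realFieldType) (V J : finType) (P : {pred J}) (s : J -> {set V}).
Variable (K : {set {set V}}).
Hypothesis s0 : forall j, j \in P -> s j != set0.
Hypothesis sK : forall A, A \in K -> exists2 j, j \in P & s j \subset A.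
Hypothesis sU : forall A j j', A \in K -> j \in P -> j' \in P ->
  s j \subset A -> s j' \subset A -> j = j'.

Lemma min_on0 (x : V -> R) A j : A \in K -> (forall i, 0 <= x i) ->
  (forall i, i \notin A -> x i = 0) -> ~~ (s j \subset A) -> min_on (s j) x = 0.
Proof.
move=> KA x0 xA /subsetPn[i sji iA]; rewrite -(xA i iA).
by apply: min_on_eq => //; rewrite xA.
Qed.

Lemma sum_unique (F : J -> R) (Q : pred J) j0 : j0 \in P ->
  (forall j, j \in P -> j != j0 -> F j = 0) ->
  \sum_(j in P | Q j) F j = if Q j0 then F j0 else 0.
Proof.
move=> Pj0 F0; case: ifP => Qj; last first.
  rewrite big1 // => j /andP[Pj Qj']; apply: F0 => //.
  by apply: contraTneq Qj' => ->; rewrite Qj.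
rewrite (bigD1 j0) ?Pj0 //= big1 ?addr0 // => j /andP[/andP[Pj _] jj]; exact: F0.
Qed.

Lemma star_polyhedron (x : V -> R) :
  polyhedron K x -> polyhedron (star_complex P s K) (star P s x).
Proof.
move=> xK; have x1 := fun i => polyhedron_le1 i xK; case: xK => x0 [xS [A KA xA]].
have [j0 Pj0 sjA] := sK KA.
have m0 j : j \in P -> j != j0 -> min_on (s j) x = 0.
  move=> Pj jj; apply: (min_on0 KA) => //; apply: contra jj => sj.
  by apply/eqP/(sU KA).
have starl i : star P s x (inl i) = x i - (if i \in s j0 then min_on (s j0) x else 0).
  by rewrite /star (sum_unique _ Pj0).
have [i0 si0] : exists i, i \in s j0 by apply/set0Pn; exact: s0.
(* The coordinate of a vertex attaining the minimum is removed entirely, so the image lies in the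
   cone that omits [i1]. *)
have [i1 si1 mi1] := @eq_bigmin _ _ _ 1 i0 (mem (s j0)) x si0 (fun i _ => x1 i).
rewrite -[LHS]/(min_on (s j0) x) in mi1.
split; [|split].
- move=> [i|j]; last by rewrite /star; case: ifP => // _; rewrite mulr_ge0 ?min_on_ge0.
  by rewrite starl; case: ifP => [si|_]; rewrite subr_ge0 ?min_on_le.
- rewrite big_sumType (eq_bigr _ (fun i _ => starl i)) sumrB /= -[RHS]xS -addrA.
  rewrite -[RHS]addr0; congr (_ + _).
  rewrite -big_mkcond /= sumr_const -mulr_natl -big_mkcond (bigD1 j0) //=.
  by rewrite big1 ?addr0 ?addNr // => j /andP[Pj jj]; rewrite m0 ?mulr0.
- exists (inr j0 |: [set inl v | v in A :\ i1]).
    rewrite inE; apply/existsP; exists A; rewrite KA /=.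
    apply/existsP; exists j0; rewrite Pj0 /=.
    by apply/existsP; exists i1; rewrite si1 sjA eqxx.
  move=> [i|j]; [rewrite starl !inE|rewrite !inE].
    rewrite [_ == _]/= mem_imset; last by move=> ? ? [].
    rewrite !inE negb_and negbK => /orP[/eqP ->|iA]; first by rewrite si1 mi1 subrr.
    rewrite xA // ifF ?subr0 //; apply: contraNF iA; exact: (subsetP sjA).
  rewrite negb_or => /andP[jj _]; rewrite /star; case: ifP => // Pj.
  rewrite m0 ?mulr0 //; by apply: contra jj => /eqP ->.
Qed.

Lemma star_complex_support (y : V + J -> R) : polyhedron (star_complex P s K) y ->
  exists A j i, [/\ [/\ A \in K, j \in P, i \in s j & s j \subset A],
    forall v, (v \notin A) || (v == i) -> y (inl v) = 0 & forall j', j' != j -> y (inr j') = 0].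
Proof.
move=> [_ [_ [B]]]; rewrite inE => /existsP[A /andP[KA /existsP[j /andP[Pj /existsP[i]]]]].
move=> /andP[si /andP[sA /eqP ->]] yB; exists A, j, i; split=> //.
- move=> v vA; apply: yB; rewrite !inE /= mem_imset; last by move=> ? ? [].
  by rewrite !inE negb_and negbK orbC.
- move=> j' jj; apply: yB; rewrite !inE negb_or; apply/andP; split.
    by apply: contra jj => /eqP[->].
  by apply/imsetP => -[].
Qed.

Lemma unstar_polyhedron (y : V + J -> R) :
  polyhedron (star_complex P s K) y -> polyhedron K (unstar P s y).
Proof.
move=> yK; have [A [j0 [i0 [[KA Pj0 si0 sA] yl yr]]]] := star_complex_support yK.
case: yK => y0 [yS _].
have unstarE i : unstar P s y i = y (inl i) + (if i \in s j0 then y (inr j0) / #|s j0|%:R else 0).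
  by rewrite /unstar (sum_unique _ Pj0) // => j Pj jj; rewrite yr ?mul0r.
split; [|split].
- by move=> i; rewrite unstarE addr_ge0 //; case: ifP => // _; rewrite divr_ge0.
- rewrite (eq_bigr _ (fun i _ => unstarE i)) big_split /= -big_mkcond /= sumr_const.
  rewrite -[X in _ + X]mulr_natr divfK ?pnatr_eq0 ?cards_eq0 ?s0 // -[RHS]yS big_sumType /=.
  by congr (_ + _); rewrite (bigD1 j0) //= big1 ?addr0 // => j jj; rewrite yr.
- exists A => // i iA; rewrite unstarE yl ?iA // ifF ?addr0 //.
  by apply: contraNF iA; exact: (subsetP sA).
Qed.

Lemma unstarK (y : V + J -> R) :
  polyhedron (star_complex P s K) y -> star P s (unstar P s y) =1 y.
Proof.
move=> yK; have [A [j0 [i0 [[KA Pj0 si0 sA] yl yr]]]] := star_complex_support yK.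
have yK' := unstar_polyhedron yK; case: yK => y0 [yS _].
have unstarE i : unstar P s y i = y (inl i) + (if i \in s j0 then y (inr j0) / #|s j0|%:R else 0).
  by rewrite /unstar (sum_unique _ Pj0) // => j Pj jj; rewrite yr ?mul0r.
(* The omitted vertex [i0] has coordinate 0 in [y], so after [unstar] it attains the minimum over
   [s j0], and this minimum gives back the weight of the new vertex. *)
have mj0 : min_on (s j0) (unstar P s y) = y (inr j0) / #|s j0|%:R.
  have <- : unstar P s y i0 = y (inr j0) / #|s j0|%:R.
    by rewrite unstarE si0 yl ?add0r // eqxx orbT.
  apply: min_on_eq => //; last exact: polyhedron_le1 yK'.
  by move=> j sj; rewrite !unstarE si0 sj (yl i0) ?add0r ?lerDr // eqxx orbT.
have mj j : j \in P -> j != j0 -> min_on (s j) (unstar P s y) = 0.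
  move=> Pj jj; apply: (@min_on0 _ A) => //; first by case: yK'.
    move=> i iA; rewrite unstarE yl ?iA // ifF ?addr0 //.
    by apply: contraNF iA; exact: (subsetP sA).
  by apply: contra jj => sj; apply/eqP/(sU KA).
move=> [i|j]; rewrite /star.
  rewrite (sum_unique _ Pj0) // unstarE; case: ifP => _; last by rewrite subr0 addr0.
  by rewrite mj0 addrK.
have [->|jj] := eqVneq j j0.
  by rewrite Pj0 mj0 mulrC divfK // pnatr_eq0 cards_eq0 s0.
by rewrite yr //; case: ifP => // Pj; rewrite mj ?mulr0.
Qed.

End Star.

(** * The division of the faces of H *)

Definition label (h : nat) : finType :=
  ('I_h + {set 'I_h} + {set 'I_h} + {set 'I_h} * {set 'I_h})%type.

Definition corner h (i : 'I_h) : label h := inl (inl (inl i)).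
Definition center h (T : {set 'I_h}) : label h := inl (inl (inr T)).
Definition midpoint h (e : {set 'I_h}) : label h := inl (inr e).
Definition apex h (T e : {set 'I_h}) : label h := inr (T, e).

(** The nested sums in [label h] are the vertex types of three successive [star_complex]. The last
    two rounds may range over all 2-sets and all pairs, because an [s j] contained in no facet
    creates no facet. *)
Definition subdivision (h : nat) (H : {set {set 'I_h}}) : {set {set label h}} :=
  let V1 := ('I_h + {set 'I_h})%type in
  let V2 := (V1 + {set 'I_h})%type in
  let K1 := star_complex (mem H) id H in
  let K2 := star_complex [pred e : {set 'I_h} | #|e| == 2%N]
              (fun e : {set 'I_h} => [set (inl i : V1) | i in e]) K1 in
  star_complex predT
    (fun Te : {set 'I_h} * {set 'I_h} => [set (inl (inr Te.1) : V2); inr Te.2]) K2.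

Lemma mem_inl_imset (V W : finType) (A : {set V}) v :
  ((inl v : V + W) \in [set inl v | v in A]) = (v \in A).
Proof. by rewrite mem_imset // => ? ? []. Qed.

Lemma mem_inr_imset (V W : finType) (A : {set V}) w :
  ((inr w : V + W) \in [set inl v | v in A]) = false.
Proof. by apply/imsetP => -[]. Qed.

Section Subdivision.
Variables (h : nat) (H : {set {set 'I_h}}).
Hypothesis H3 : uniform3 H.
Let V1 := ('I_h + {set 'I_h})%type.
Let V2 := (V1 + {set 'I_h})%type.
Let K1 := star_complex (mem H) id H.
Let K2 := star_complex [pred e : {set 'I_h} | #|e| == 2%N]
              (fun e : {set 'I_h} => [set (inl i : V1) | i in e]) K1.

Lemma centered_facet (A : {set V1}) : A \in K1 ->
  exists T k, [/\ T \in H, k \in T & A = (inr T |: [set inl v | v in T :\ k])].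
Proof.
rewrite inE => /existsP[A' /andP[HA' /existsP[T /andP[/= TH /existsP[k]]]]].
move=> /andP[kT /andP[TA /eqP ->]]; exists T, k; split=> //.
suff -> : A' = T by [].
by apply/esym/eqP; rewrite eqEcard TA !H3.
Qed.

Lemma card_face (T : {set 'I_h}) k : T \in H -> k \in T -> #|(T :\ k)| = 2%N.
Proof. by move=> /H3 T3 kT; have := cardsD1 k T; rewrite T3 kT => -[]. Qed.

Lemma centered_facet_edge (T e : {set 'I_h}) k : T \in H -> k \in T -> #|e| = 2%N ->
  [set (inl i : V1) | i in e] \subset (inr T |: [set inl v | v in T :\ k]) ->
  e = (T :\ k).
Proof.
move=> TH kT e2 /subsetP sub; apply/eqP; rewrite eqEcard card_face // e2 leqnn andbT.
by apply/subsetP => i ie; have := sub (inl i); rewrite in_setU1 !mem_inl_imset; exact.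
Qed.

(** After two rounds the facets are those of the barycentric subdivision: the only pair of corners
    left in a facet of [K1] is the edge opposite [k], and its midpoint replaces one of the two
    corners. *)
Lemma bisected_facet (A : {set V2}) : A \in K2 ->
  exists T k i, [/\ T \in H, k \in T, i \in (T :\ k) &
    A = [set inr (T :\ k); inl (inr T); inl (inl i)]].
Proof.
rewrite inE => /existsP[A' /andP[/centered_facet[T [k [TH kT ->]]]]].
move=> /existsP[e /andP[/eqP e2 /existsP[_ /andP[/imsetP[j je ->]]]]].
move=> /andP[/(centered_facet_edge TH kT e2) eE /eqP ->]; subst e.
have /eqP/cards1P[i ei] : #|((T :\ k) :\ j)| = 1%N.
  by have := cardsD1 j (T :\ k); rewrite e2 je => -[].
have iE x : (x \in ((T :\ k) :\ j)) = (x == i) by rewrite ei inE.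
exists T, k, i; split=> //.
  by have := eqxx i; rewrite -iE !in_setD1 => /andP[].
apply/setP => -[[x|T']|e']; rewrite in_setU1 !inE ?mem_inl_imset ?mem_inr_imset /=.
- by have := iE x; rewrite !(in_setD1, in_setU1) mem_inl_imset in_setD1 /= => ->.
- by rewrite !(in_setD1, in_setU1) mem_inr_imset !orbF.
- by rewrite !orbF.
Qed.

(** The list of triangles that an embedding must send to edges of G. The apex depends on the face
    and the edge but not on the corner, so one vertex serves four triangles. *)
Lemma subdivision_facet (B : {set label h}) : B \in subdivision H -> exists T k i b,
    [/\ [/\ T \in H, k \in T, i \in (T :\ k) &
          b = midpoint (T :\ k) \/ b = center T] &
        B = [set apex T (T :\ k); corner i; b]].
Proof.
rewrite inE => /existsP[A /andP[/bisected_facet[T [k [i [TH kT ik ->]]]]]].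
move=> /existsP[[T' e'] /andP[_ /existsP[z /andP[/= zs /andP[/subsetP sub /eqP ->]]]]].
have := sub (inl (inr T')); rewrite !inE eqxx /= orbF => /(_ isT)/eqP[TT]; subst T'.
have := sub (inr e'); rewrite !inE eqxx orbT !orbF => /(_ isT)/eqP[ee]; subst e'.
(* Of the two ends of the starred segment, dropping the centre leaves the midpoint, and
   conversely. *)
move: zs; rewrite !inE => /orP[]/eqP ->.
  exists T, k, i, (midpoint (T :\ k)); split; first by split=> //; left.
  apply/setP => -[[[x|T']|e']|Te]; rewrite !inE ?mem_inl_imset ?mem_inr_imset ?inE
    /corner /midpoint /apex.
  + by rewrite /= !orbF.
  + by rewrite /= !orbF andNb.
  + by rewrite /= !orbF.
  + by rewrite /= !orbF.
exists T, k, i, (center T); split; first by split=> //; right.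
apply/setP => -[[[x|T']|e']|Te]; rewrite !inE ?mem_inl_imset ?mem_inr_imset ?inE
  /corner /center /apex.
- by rewrite /= !orbF.
- by rewrite /= !orbF.
- by rewrite /= !orbF andNb.
- by rewrite /= !orbF.
Qed.

End Subdivision.

(** * Finding the subdivision in a dense 3-graph *)

(** Greedy choice: at each step [X] and fewer than [#|I|] earlier values are forbidden, so a value
    in [S i] remains. *)
Lemma injective_choice (V I : finType) (X : {set V}) (S : I -> {set V}) :
  (forall i, #|X| + #|I| <= #|S i|)%N ->
  exists f : I -> V, injective f /\ forall i, f i \in S i /\ f i \notin X.
Proof.
move=> XS.
suff [f [finj fS]] : exists f : I -> V, {in enum I &, injective f} /\
    {in enum I, forall i, f i \in S i /\ f i \notin X}.
  exists f; split=> [i j|i]; first by apply: finj; rewrite mem_enum.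
  by apply: fS; rewrite mem_enum.
have : (size (enum I) <= #|I|)%N by rewrite cardE.
elim: (enum I) => [_|i r IH rI].
  have /fin_all_exists[f _] : forall i, exists v, v \in S i.
    move=> i; apply/set0Pn; rewrite -card_gt0; apply: leq_trans (XS i).
    by rewrite addn_gt0 orbC; apply/orP; left; apply/card_gt0P; exists i.
  by exists f.
have [f [finj fS]] := IH (ltnW rI).
have [ir|ir] := boolP (i \in r).
  have sub : {subset i :: r <= r} by move=> j; rewrite inE => /predU1P[->|].
  by exists f; split=> [j k /sub jr /sub kr|j /sub jr]; [exact: finj|exact: fS].
have [y] : exists y, y \in S i :\: (X :|: [set y in map f r]).
  apply/set0Pn; rewrite -card_gt0 cardsD subn_gt0.
  apply: leq_ltn_trans (subset_leq_card (subsetIr _ _)) _.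
  apply: leq_ltn_trans (leq_card_setU _ _) _; apply: leq_trans (XS i).
  rewrite ltn_add2l; apply: leq_trans rI; rewrite ltnS cardsE.
  by apply: leq_trans (card_size _) _; rewrite size_map.
rewrite !inE negb_or => /andP[/andP[yX yr] yS].
have fy j : j \in r -> f j != y by move=> jr; apply: contraNneq yr => <-; exact: map_f.
exists (fun j => if j == i then y else f j); split=> [j k|j]; rewrite !inE.
  case: (j =P i) => [-> _|_ /= jr]; case: (k =P i) => [-> //|_ /= kr].
  - by move=> yf; have := fy k kr; rewrite -yf eqxx.
  - by move=> _ fyj; have := fy j jr; rewrite fyj eqxx.
  - exact: finj.
by case: eqP => [->|_ /= jr]; [|exact: fS].
Qed.

Lemma card_sum_bool (T : finType) (P : pred T) : #|[set t | P t]| = (\sum_t P t)%N.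
Proof. by rewrite -sum1dep_card big_mkcond. Qed.

Lemma union_bound (T S : finType) (P : pred T) (Q : T -> S -> bool) :
  (forall t, P t -> exists s, Q t s) ->
  (#|[set t | P t]| <= \sum_s #|[set t | P t && Q t s]|)%N.
Proof.
move=> PQ; rewrite card_sum_bool; under [leqRHS]eq_bigr do rewrite card_sum_bool.
rewrite exchange_big leq_sum //= => t _; case Pt: (P t) => //=.
by have [s Qs] := PQ t Pt; rewrite (bigD1 s) //= Qs.
Qed.

(** * Random maps avoiding bad triples *)

Section AvoidTriples.
Variables (V : finType) (h : nat) (U : {set V}) (B : pred (V * V * V)).
Let bad := [set t : V * V * V | [&& t.1.1 \in U, t.1.2 \in U, t.2 \in U & B t]].

(** In probabilistic terms, for a uniform map to [U] the values at three distinct indices form a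
    uniform triple. The injection [F] shows this by exchanging these values with an independent
    triple [t]. *)
Lemma card_bad_maps (i j k : 'I_h) : i != j -> i != k -> j != k ->
  (#|[set f : {ffun 'I_h -> V} | (f \in ffun_on U) && B (f i, f j, f k)]| * #|U| ^ 3
   <= #|bad| * #|U| ^ h)%N.
Proof.
move=> ij ik jk; set A := [set f | _].
have -> : (#|U| ^ 3 = #|setX (setX U U) U|)%N by rewrite !cardsX; lia.
have -> : (#|U| ^ h = #|[set f : {ffun 'I_h -> V} | f \in ffun_on U]|)%N.
  by rewrite cardsE card_ffun_on card_ord.
rewrite -!cardsX.
pose upd (f : {ffun 'I_h -> V}) (t : V * V * V) : {ffun 'I_h -> V} :=
  [ffun l => if l == i then t.1.1 else if l == j then t.1.2 else if l == k then t.2 else f l].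
pose F (p : {ffun 'I_h -> V} * (V * V * V)) := ((p.1 i, p.1 j, p.1 k), upd p.1 p.2).
have F_inj : injective F.
  move=> [f t] [f' t'] [fi fj fk /ffunP uE].
  have ff : f = f'.
    apply/ffunP => l; have := uE l; rewrite !ffunE.
    case: eqP => [->|_] //; case: eqP => [->|_] //; by case: eqP => [->|].
  move: (uE i) (uE j) (uE k); rewrite !ffunE !eqxx.
  rewrite eq_sym (negPf ij) (eq_sym k) (negPf ik) (eq_sym k) (negPf jk) /= => t1 t2 t3.
  by rewrite ff; congr pair; case: t t' t1 t2 t3 {uE} => [[a b] c] [[a' b'] c'] /= -> -> ->.
rewrite -(card_imset _ F_inj); apply/subset_leq_card/subsetP => _ /imsetP[[f t] + ->].
rewrite !inE /= => /andP[/andP[/ffun_onP fU Bf] /andP[/andP[t1 t2] t3]].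
rewrite !fU Bf /=; apply/ffun_onP => l; rewrite ffunE.
by case: ifP => // _; case: ifP => // _; case: ifP.
Qed.

(** There are at most [h ^ 3] index triples, so by the hypothesis the expected number of bad ones is
    below 1. *)
Lemma avoid_triples : (0 < #|U|)%N -> (h ^ 3 * #|bad| < #|U| ^ 3)%N ->
  exists f : 'I_h -> V, (forall i, f i \in U) /\
    forall i j k, i != j -> i != k -> j != k -> ~~ B (f i, f j, f k).
Proof.
move=> U0 bU.
pose D (f : {ffun 'I_h -> V}) (s : 'I_h * 'I_h * 'I_h) :=
  [&& s.1.1 != s.1.2, s.1.1 != s.2, s.1.2 != s.2 & B (f s.1.1, f s.1.2, f s.2)].
have [f /andP[/ffun_onP fU /existsPn fB]|none] :=
    pickP [pred f : {ffun 'I_h -> V} | (f \in ffun_on U) && ~~ [exists s, D f s]].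
  exists f; split=> // i j k ij ik jk; have := fB (i, j, k).
  by rewrite /D /= ij ik jk.
have ub := @union_bound _ _ (fun f : {ffun 'I_h -> V} => f \in ffun_on U) D.
have : forall f : {ffun 'I_h -> V}, f \in ffun_on U -> exists s, D f s.
  by move=> f fU; apply/existsP; apply: contraFT (none f) => nD /=; rewrite fU.
move/ub; rewrite cardsE card_ffun_on card_ord leqNgt => /negP[].
rewrite -(ltn_pmul2r (m := #|U| ^ 3)) ?expn_gt0 ?U0 // big_distrl /=.
have bnd s : (#|[set f : {ffun 'I_h -> V} | (f \in ffun_on U) && D f s]| * #|U| ^ 3
    <= #|bad| * #|U| ^ h)%N.
  have [/and3P[ij ik jk]|ns] := boolP [&& s.1.1 != s.1.2, s.1.1 != s.2 & s.1.2 != s.2].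
    apply: leq_trans (card_bad_maps ij ik jk); rewrite leq_mul2r; apply/orP; right.
    apply/subset_leq_card/subsetP => f; rewrite !inE => /andP[-> /and4P[_ _ _ ->]] //.
  rewrite (_ : [set f | _] = set0) ?cards0 //; apply/setP => f; rewrite !inE.
  by apply: contraNF ns => /andP[_ /and4P[-> -> ->]].
apply: (@leq_ltn_trans (\sum_(s : 'I_h * 'I_h * 'I_h) #|bad| * #|U| ^ h)).
  by apply: leq_sum => s _; exact: bnd.
rewrite sum_nat_const !card_prod card_ord mulnA [ltnRHS]mulnC ltn_pmul2r ?expn_gt0 ?U0 //.
by rewrite (_ : (h * h * h = h ^ 3)%N) //; lia.
Qed.

End AvoidTriples.

(** * Links, fillers and the expected number of bad triples *)

Section Links.
Variables (V : finType) (g : V -> V -> V -> bool).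

Definition link2 (w v1 v2 : V) : {set V} := [set b | g v1 b w && g v2 b w].
Definition link3 (w v1 v2 v3 : V) : {set V} := [set b | [&& g v1 b w, g v2 b w & g v3 b w]].
(** The candidate apexes of the quadrilateral [v1], [m], [v2], [c]. *)
Definition fillers (v1 v2 m c : V) : {set V} :=
  [set w | [&& g v1 m w, g v2 m w, g v1 c w & g v2 c w]].
Definition badpairs (q : nat) (w v1 v2 v3 : V) : {set V * V} :=
  [set mc | [&& mc.1 \in link2 w v1 v2, mc.2 \in link3 w v1 v2 v3 &
                (#|fillers v1 v2 mc.1 mc.2| < q)%N]].

Variables (R : realFieldType) (h q : nat) (d2 d3 : R).
Definition low2 (w v1 v2 : V) := #|link2 w v1 v2|%:R < d2.
Definition low3 (w v1 v2 v3 : V) := #|link3 w v1 v2 v3|%:R < d3.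
(** A proportion below [1 / (8 * h)] of bad pairs is what the greedy choice of midpoints can afford.
    Requiring [~~ low2] allows the division by [d2] in [sum_heavy]. *)
Definition heavy (w v1 v2 v3 : V) := ~~ low2 w v1 v2 &&
  (#|link2 w v1 v2| * #|link3 w v1 v2 v3| <= 8 * h * #|badpairs q w v1 v2 v3|)%N.
(** Equality is tested on the first two entries only: all orderings of the indices are avoided
    later, which already makes the placement of the corners injective. *)
Definition bad_triple (w : V) (t : V * V * V) :=
  [|| t.1.1 == t.1.2, low2 w t.1.1 t.1.2, low3 w t.1.1 t.1.2 t.2 | heavy w t.1.1 t.1.2 t.2].
Definition fiber (w b : V) : {set V} := [set v | g v b w].

Lemma sumr_bool (T : finType) (P : pred T) : \sum_t (P t)%:R = #|[set t | P t]|%:R :> R.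
Proof. by rewrite card_sum_bool natr_sum. Qed.

Let n : R := #|V|%:R.

(** Exchange the sums: a pair lies in [fiber w b] exactly when [b] is in its [link2], hence for
    fewer than [d2] values of [b] if the pair is low. *)
Lemma sum_low2 w : 0 <= d2 ->
  \sum_b #|[set p : V * V | [&& p.1 \in fiber w b, p.2 \in fiber w b & low2 w p.1 p.2]]|%:R
    <= n ^+ 2 * d2.
Proof.
move=> d0; under eq_bigr do rewrite -sumr_bool.
rewrite exchange_big /= (_ : n ^+ 2 * d2 = \sum_(p : V * V) d2); last first.
  by rewrite sumr_const card_prod -mulr_natl natrM expr2.
apply: ler_sum => p _; rewrite sumr_bool.
have [lp|_] := boolP (low2 w p.1 p.2).
  rewrite (_ : [set _ | _] = link2 w p.1 p.2) ?ltW //.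
  by apply/setP => b; rewrite !inE andbT.
by rewrite (_ : [set _ | _] = set0) ?cards0 //; apply/setP => b; rewrite !inE !andbF.
Qed.

Lemma sum_low3 w : 0 <= d3 ->
  \sum_b #|[set t : V * V * V | [&& t.1.1 \in fiber w b, t.1.2 \in fiber w b,
              t.2 \in fiber w b & low3 w t.1.1 t.1.2 t.2]]|%:R <= n ^+ 3 * d3.
Proof.
move=> d0; under eq_bigr do rewrite -sumr_bool.
rewrite exchange_big /= (_ : n ^+ 3 * d3 = \sum_(t : V * V * V) d3); last first.
  by rewrite sumr_const !card_prod -mulr_natl !natrM 2!exprSr expr1.
apply: ler_sum => t _; rewrite sumr_bool.
have [lt|_] := boolP (low3 w t.1.1 t.1.2 t.2).
  rewrite (_ : [set _ | _] = link3 w t.1.1 t.1.2 t.2) ?ltW //.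
  by apply/setP => b; rewrite !inE andbT.
by rewrite (_ : [set _ | _] = set0) ?cards0 //; apply/setP => b; rewrite !inE !andbF.
Qed.

(** For fixed [(m, c)], each [w] for which the pair is bad is itself one of its fillers, and a bad
    pair has fewer than [q] of them. *)
Lemma sum_badpairs v1 v2 v3 : (\sum_w #|badpairs q w v1 v2 v3| <= #|V| ^ 2 * q)%N.
Proof.
under eq_bigr do rewrite card_sum_bool.
rewrite exchange_big /= (_ : (#|V| ^ 2 * q = \sum_(mc : V * V) q)%N); last first.
  by rewrite sum_nat_const card_prod mulnn.
apply: leq_sum => mc _; rewrite -card_sum_bool.
have [lq|gq] := boolP (#|fillers v1 v2 mc.1 mc.2| < q)%N; last first.
  by rewrite (_ : [set _ | _] = set0) ?cards0 //; apply/setP => w; rewrite !inE !andbF.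
apply: leq_trans (ltnW lq); apply/subset_leq_card/subsetP => w; rewrite !inE andbT.
by move=> /andP[/andP[-> ->] /and3P[-> -> _]].
Qed.

(** A triple lies in the fiber for [#|link3|] values of [b]. If it is heavy, [#|link2|] is at least
    [d2], so [#|link3|] is at most [8 * h / d2] times its number of bad pairs; then [sum_badpairs]
    is summed over [n ^ 3] triples. *)
Lemma sum_heavy : 0 < d2 ->
  \sum_w \sum_b #|[set t : V * V * V | [&& t.1.1 \in fiber w b, t.1.2 \in fiber w b,
              t.2 \in fiber w b & heavy w t.1.1 t.1.2 t.2]]|%:R
    <= (8 * h * q)%:R * n ^+ 5 / d2.
Proof.
move=> d0; have -> : (8 * h * q)%:R * n ^+ 5 / d2 =
    \sum_(t : V * V * V) (8 * h)%:R / d2 * (#|V| ^ 2 * q)%:R.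
  rewrite sumr_const !card_prod -[RHS]mulr_natl !natrM /n.
  by field; rewrite gt_eqF.
have heavyP w (t : V * V * V) :
    \sum_b (([&& t.1.1 \in fiber w b, t.1.2 \in fiber w b,
              t.2 \in fiber w b & heavy w t.1.1 t.1.2 t.2] : nat)%:R : R) <=
    (8 * h)%:R / d2 * #|badpairs q w t.1.1 t.1.2 t.2|%:R.
  rewrite sumr_bool; have [/andP[nl hv]|_] := boolP (heavy w t.1.1 t.1.2 t.2); last first.
    rewrite (_ : [set _ | _] = set0); last by apply/setP => b; rewrite !inE !andbF.
    by rewrite cards0 mulr_ge0 // divr_ge0 // ltW.
  rewrite (_ : [set _ | _] = link3 w t.1.1 t.1.2 t.2); last first.
    by apply/setP => b; rewrite !inE andbT.
  rewrite mulrAC ler_pdivlMr //.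
  have : (#|link2 w t.1.1 t.1.2| * #|link3 w t.1.1 t.1.2 t.2|)%:R <=
      (8 * h * #|badpairs q w t.1.1 t.1.2 t.2|)%:R :> R by rewrite ler_nat.
  rewrite !natrM; apply: le_trans; rewrite mulrC ler_wpM2r //.
  by rewrite leNgt.
apply: (@le_trans _ _ (\sum_w \sum_(t : V * V * V)
    (8 * h)%:R / d2 * #|badpairs q w t.1.1 t.1.2 t.2|%:R)).
  apply: ler_sum => w _; under eq_bigr do rewrite -sumr_bool.
  by rewrite exchange_big; apply: ler_sum => t _; exact: heavyP.
rewrite exchange_big; apply: ler_sum => t _; rewrite -mulr_sumr ler_wpM2l //.
  by rewrite divr_ge0 // ltW.
by rewrite -natr_sum ler_nat; exact: sum_badpairs.
Qed.

Lemma card_bad_triples w b (U := fiber w b) :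
  (#|[set t : V * V * V | [&& t.1.1 \in U, t.1.2 \in U, t.2 \in U & bad_triple w t]]| <=
   #|U| ^ 2 +
   #|[set p : V * V | [&& p.1 \in U, p.2 \in U & low2 w p.1 p.2]]| * #|U| +
   #|[set t : V * V * V | [&& t.1.1 \in U, t.1.2 \in U, t.2 \in U & low3 w t.1.1 t.1.2 t.2]]| +
   #|[set t : V * V * V | [&& t.1.1 \in U, t.1.2 \in U, t.2 \in U & heavy w t.1.1 t.1.2 t.2]]|)%N.
Proof.
set A2 := [set p | [&& _, _ & low2 _ _ _]]; set A3 := [set t | [&& _, _, _ & low3 _ _ _ _]].
set A4 := [set t | [&& _, _, _ & heavy _ _ _ _]].
have -> : (#|U| ^ 2 = #|[set (p.1, p.1, p.2) | p in setX U U]|)%N.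
  by rewrite card_imset ?cardsX // => -[? ?] [? ?] [-> _ ->].
rewrite -cardsX; set A1 := [set _ | _ in _].
apply: (@leq_trans #|A1 :|: setX A2 U :|: A3 :|: A4|).
  apply/subset_leq_card/subsetP => -[[v1 v2] v3]; rewrite !inE /= => /and4P[v1U v2U v3U].
  rewrite /bad_triple v1U v2U v3U /= => /or4P[/eqP <-|->|->|->]; rewrite ?orbT //.
  apply/orP; left; apply/orP; left; apply/orP; left.
  by apply/imsetP; exists (v1, v3); rewrite // !inE v1U.
do 2!(apply: leq_trans (leq_card_setU _ _) _; rewrite leq_add2r).
exact: leq_card_setU.
Qed.

End Links.

(** First moment method. On average over [(w, b)] the size of the fiber divided by [D] is at least
    1, while the weighted penalties for low pairs, low triples and heavy triples average at most 1/6
    each. The bound on [D ^+ 5] serves the heavy triples. *)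
Lemma exists_good_fiber (R : realFieldType) (V : finType) (g : V -> V -> V -> bool)
    (h q : nat) (D : R) (n := #|V|%:R : R) :
  (0 < h)%N -> (0 < #|V|)%N -> 0 < D ->
  D * n ^+ 2 <= \sum_w \sum_b #|fiber g w b|%:R ->
  (q * (8 * h) * (600 * h ^ 3) ^ 2)%:R * n ^+ 4 <= D ^+ 5 ->
  (9 * h ^ 3)%:R <= D ->
  exists w b, let U := fiber g w b in (0 < #|U|)%N /\
    (h ^ 3 * #|[set t : V * V * V | [&& t.1.1 \in U, t.1.2 \in U, t.2 \in U &
       bad_triple g h q (D ^+ 2 / ((600 * h ^ 3)%:R * n))
         (D ^+ 3 / ((600 * h ^ 3)%:R * n ^+ 2)) w t]]|
     < #|U| ^ 3)%N.
Proof.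
move=> h0 V0 D0 HD HK Dh.
set d2 := D ^+ 2 / _; set d3 := D ^+ 3 / _.
have n0 : 0 < n by rewrite ltr0n.
set H : R := (h ^ 3)%:R; have H0 : 1 <= H by rewrite ler1n expn_gt0 h0.
have d20 : 0 < d2 by rewrite divr_gt0 ?exprn_gt0 // mulr_gt0 // natrM -/H; lra.
have d30 : 0 < d3 by rewrite divr_gt0 ?exprn_gt0 // mulr_gt0 ?exprn_gt0 // natrM -/H; lra.
pose s2 w b : R := #|[set p : V * V | [&& p.1 \in fiber g w b, p.2 \in fiber g w b &
  low2 g d2 w p.1 p.2]]|%:R.
pose s3 w b : R := #|[set t : V * V * V | [&& t.1.1 \in fiber g w b, t.1.2 \in fiber g w b,
  t.2 \in fiber g w b & low3 g d3 w t.1.1 t.1.2 t.2]]|%:R.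
pose s4 w b : R := #|[set t : V * V * V | [&& t.1.1 \in fiber g w b, t.1.2 \in fiber g w b,
  t.2 \in fiber g w b & heavy g h q d2 w t.1.1 t.1.2 t.2]]|%:R.
pose K := 100 * H.
(* The average of size minus penalties is at least 1/2, so asking for 1/4 leaves room. *)
have [[w b] /= good|none] := pickP [pred wb : V * V |
  4^-1 + K * (s2 wb.1 wb.2 / D ^+ 2 + s3 wb.1 wb.2 / D ^+ 3 + s4 wb.1 wb.2 / D ^+ 3) <=
  #|fiber g wb.1 wb.2|%:R / D].
- exists w, b; set U := fiber g w b; set u : R := #|U|%:R in good *.
  have s20 : 0 <= s2 w b by [].
  have s30 : 0 <= s3 w b by [].
  have s40 : 0 <= s4 w b by [].
  have D2 : 0 < D ^+ 2 by rewrite exprn_gt0.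
  have D3 : 0 < D ^+ 3 by rewrite exprn_gt0.
  have t2 : 0 <= s2 w b / D ^+ 2 by rewrite divr_ge0 // ltW.
  have t3 : 0 <= s3 w b / D ^+ 3 by rewrite divr_ge0 // ltW.
  have t4 : 0 <= s4 w b / D ^+ 3 by rewrite divr_ge0 // ltW.
  have uD : D <= 4 * u.
    have : 4^-1 <= u / D by apply: le_trans good; rewrite lerDl /K; nra.
    by rewrite ler_pdivlMr //; lra.
  have u0 : 0 < u by lra.
  have Du : D ^+ 2 <= 16 * u ^+ 2 by nra.
  have b2 : K * s2 w b <= 4 * u ^+ 2.
    have : K * (s2 w b / D ^+ 2) <= u / D by apply: le_trans good; rewrite /K; nra.
    rewrite mulrA ler_pdivrMr // (_ : u / D * D ^+ 2 = u * D); last by field; rewrite gt_eqF.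
    by move/le_trans; apply; nra.
  have b3 : K * s3 w b <= 16 * u ^+ 3.
    have : K * (s3 w b / D ^+ 3) <= u / D by apply: le_trans good; rewrite /K; nra.
    rewrite mulrA ler_pdivrMr // (_ : u / D * D ^+ 3 = u * D ^+ 2); last by field; rewrite gt_eqF.
    by move/le_trans; apply; rewrite (_ : 16 * u ^+ 3 = u * (16 * u ^+ 2)) ?ler_pM2l //; ring.
  have b4 : K * s4 w b <= 16 * u ^+ 3.
    have : K * (s4 w b / D ^+ 3) <= u / D by apply: le_trans good; rewrite /K; nra.
    rewrite mulrA ler_pdivrMr // (_ : u / D * D ^+ 3 = u * D ^+ 2); last by field; rewrite gt_eqF.
    by move/le_trans; apply; rewrite (_ : 16 * u ^+ 3 = u * (16 * u ^+ 2)) ?ler_pM2l //; ring.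
  split; first by rewrite -(ltr0n R).
  rewrite -(ltr_nat R).
  have /(leq_mul (leqnn (h ^ 3)))  := card_bad_triples g h q d2 d3 w b.
  rewrite -(ler_nat R) => /le_lt_trans; apply.
  rewrite natrM !natrD natrM -/U -/(s2 w b) -/(s3 w b) -/(s4 w b) !natrX -/u -/H.
  have uH : 9 * H <= 4 * u by apply: le_trans uD; rewrite natrM in Dh.
  have c1 : H * u ^+ 2 <= 4 / 9 * u ^+ 3.
    have -> : 4 / 9 * u ^+ 3 = 4 / 9 * u * u ^+ 2 by ring.
    by rewrite ler_wpM2r ?sqr_ge0 //; lra.
  have c2 : H * (s2 w b * u) <= 4 / 100 * u ^+ 3.
    have -> : 4 / 100 * u ^+ 3 = 4 / 100 * u ^+ 2 * u by ring.
    by rewrite mulrA ler_pM2r //; rewrite /K in b2; lra.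
  have u3 : 0 < u ^+ 3 by rewrite exprn_gt0.
  (* The four kinds of bad triples take at most 4/9, 4/100, 16/100 and 16/100 of [u ^+ 3], together
     less than 1. *)
  by rewrite /K in b3 b4; lra.
- exfalso.
  (* If no pair were good, the total would be at most [n ^+ 2 / 4]; the bounds below give at least
     [n ^+ 2 / 2]. *)
  have S1 : \sum_w \sum_b #|fiber g w b|%:R / D >= n ^+ 2.
    have -> : \sum_w \sum_b #|fiber g w b|%:R / D = (\sum_w \sum_b #|fiber g w b|%:R) / D.
      by rewrite mulr_suml; apply: eq_bigr => w _; rewrite mulr_suml.
    by rewrite ler_pdivlMr // mulrC.
  have S2 : \sum_w \sum_b s2 w b <= n ^+ 3 * d2.
    rewrite (_ : n ^+ 3 * d2 = \sum_(w : V) n ^+ 2 * d2); last first.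
      by rewrite sumr_const -mulr_natl mulrA -exprS.
    by apply: ler_sum => w _; apply: sum_low2; exact: ltW.
  have S3 : \sum_w \sum_b s3 w b <= n ^+ 4 * d3.
    rewrite (_ : n ^+ 4 * d3 = \sum_(w : V) n ^+ 3 * d3); last first.
      by rewrite sumr_const -mulr_natl mulrA -exprS.
    by apply: ler_sum => w _; apply: sum_low3; exact: ltW.
  have S4 : \sum_w \sum_b s4 w b <= (8 * h * q)%:R * n ^+ 5 / d2 by exact: sum_heavy.
  have : \sum_(w : V) \sum_(b : V) (#|fiber g w b|%:R / D -
     K * (s2 w b / D ^+ 2 + s3 w b / D ^+ 3 + s4 w b / D ^+ 3)) <= n ^+ 2 / 4.
    rewrite (_ : n ^+ 2 / 4 = \sum_(w : V) \sum_(b : V) 4^-1); last first.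
      by rewrite !sumr_const -mulrnA -[RHS]mulr_natl natrM expr2.
    apply: ler_sum => w _; apply: ler_sum => b _.
    by have /negbT := none (w, b); rewrite /= -ltNge; lra.
  have -> : \sum_(w : V) \sum_(b : V) (#|fiber g w b|%:R / D -
     K * (s2 w b / D ^+ 2 + s3 w b / D ^+ 3 + s4 w b / D ^+ 3)) =
    (\sum_w \sum_b #|fiber g w b|%:R / D) - K * ((\sum_w \sum_b s2 w b) / D ^+ 2 +
      (\sum_w \sum_b s3 w b) / D ^+ 3 + (\sum_w \sum_b s4 w b) / D ^+ 3).
    rewrite !mulr_suml -!big_split /= mulr_sumr -sumrB; apply: eq_bigr => w _.
    by rewrite !mulr_suml -!big_split /= mulr_sumr -sumrB.
  have D2 : 0 < D ^+ 2 by rewrite exprn_gt0.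
  have D3 : 0 < D ^+ 3 by rewrite exprn_gt0.
  have K0 : 0 < K by rewrite /K; lra.
  have nz : n != 0 by rewrite gt_eqF.
  have Dz : D != 0 by rewrite gt_eqF.
  have Hz : h%:R != 0 :> R by rewrite pnatr_eq0 -lt0n.
  have n20 : 0 < n ^+ 2 by rewrite exprn_gt0.
  have e2 : K * ((\sum_w \sum_b s2 w b) / D ^+ 2) <= n ^+ 2 / 6.
    rewrite (_ : n ^+ 2 / 6 = K * (n ^+ 3 * d2 / D ^+ 2)).
      by rewrite ler_pM2l // ler_pM2r ?invr_gt0.
    by rewrite /K /d2 natrM -/H; field; rewrite -/n nz Dz Hz.
  have e3 : K * ((\sum_w \sum_b s3 w b) / D ^+ 3) <= n ^+ 2 / 6.
    rewrite (_ : n ^+ 2 / 6 = K * (n ^+ 4 * d3 / D ^+ 3)).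
      by rewrite ler_pM2l // ler_pM2r ?invr_gt0.
    by rewrite /K /d3 natrM -/H; field; rewrite -/n nz Dz Hz.
  have e4 : K * ((\sum_w \sum_b s4 w b) / D ^+ 3) <= n ^+ 2 / 6.
    apply: (@le_trans _ _ (K * ((8 * h * q)%:R * n ^+ 5 / d2 / D ^+ 3))).
      by rewrite ler_pM2l // ler_pM2r ?invr_gt0.
    rewrite (_ : _ * _ = ((q * (8 * h) * (600 * h ^ 3) ^ 2)%:R * n ^+ 4 / D ^+ 5) * (n ^+ 2 / 6)).
      by rewrite ger_pMl ?divr_gt0 // ler_pdivrMr ?exprn_gt0 // mul1r.
    by rewrite /K /d2 !natrM /H; field; rewrite -/n nz Dz Hz.
  by rewrite !mulrDr; lra.
Qed.

(** * Greedy choice of midpoints, centres and apexes *)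

Section Greedy.
Local Open Scope nat_scope.
Variables (V : finType) (g : V -> V -> V -> bool) (h : nat) (w0 : V) (v : 'I_h -> V).
Let L := #|label h|.

Definition links (S : {set 'I_h}) : {set V} := [set b | [forall i in S, g (v i) b w0]].
Definition fills (e : {set 'I_h}) (m c : V) : {set V} :=
  [set w | [forall i in e, g (v i) m w && g (v i) c w]].

Hypothesis v_inj : injective v.
Hypothesis V_large : L <= #|V|.
Hypothesis links_large : forall (T : {set 'I_h}) k, #|T| = 3 -> k \in T ->
  4 * L <= #|links (T :\ k)| /\ 4 * L <= #|links T|.
Hypothesis few_bad : forall (T : {set 'I_h}) k, #|T| = 3 -> k \in T ->
  8 * h * #|[set mc | [&& mc.1 \in links (T :\ k), mc.2 \in links T &
                #|fills (T :\ k) mc.1 mc.2| < L]]| < #|links (T :\ k)| * #|links T|.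

Let badc e T m := [set c in links T | #|fills e m c| < L].
(** Midpoints that spoil less than a quarter of the centres of every face through [e]. The three
    edges of a face then spoil less than three quarters together. *)
Let goodm e := [set m in links e |
  [forall k, (k \notin e) ==> (4 * #|badc e (k |: e) m| < #|links (k |: e)|)]].

(** Markov's inequality: by [few_bad], each third vertex [l] excludes at most a fraction
    [1 / (2 * h)] of [links e]. Over the [h] choices of [l], half of [links e] survives. *)
Lemma card_goodm (T : {set 'I_h}) k : #|T| = 3 -> k \in T -> 2 * L <= #|goodm (T :\ k)|.
Proof.
move=> T3 kT; set e := T :\ k.
have [large _] := links_large T3 kT.
have addT l : l \notin e -> #|l |: e| = 3 /\ (l |: e) :\ l = e.
  move=> le; rewrite cardsU1 le setU1K //; split=> //.
  by have := cardsD1 k T; rewrite T3 kT -/e /=; lia.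
pose badm l := [set m | (m \in links e) && ((l \notin e) &&
                  (#|links (l |: e)| <= 4 * #|badc e (l |: e) m|))].
have badm_small l : 2 * h * #|badm l| <= #|links e|.
  have [le|le] := boolP (l \in e).
    rewrite (_ : badm l = set0) ?cards0 ?muln0 //.
    by apply/setP => m; rewrite [LHS]inE le /= andbF inE.
  have [T3' eE] := addT l le.
  have := few_bad T3' (setU11 l e); have [_ large'] := links_large T3' (setU11 l e).
  rewrite eE; set T' := l |: e in large' *; set Bd := [set _ | _] => Bdlt.
  have L0 : 0 < L by apply/card_gt0P; exists (center set0).
  have T'0 : 0 < #|links T'| by lia.
  rewrite -(leq_pmul2r T'0).
  suff : #|badm l| * #|links T'| <= 4 * #|Bd| by nia.
  have -> : #|Bd| = \sum_(m in links e) #|badc e T' m|.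
    transitivity (\sum_m \sum_c ((m \in links e) && (c \in badc e T' m) : nat)).
      rewrite pair_bigA card_sum_bool; apply: eq_bigr => mc _ /=.
      by rewrite [mc.2 \in badc _ _ _]inE.
    rewrite [RHS]big_mkcond; apply: eq_bigr => m _; case: (m \in links e) => /=.
      by rewrite -sum1_card [RHS]big_mkcond.
    by rewrite big1.
  rewrite big_distrr -sum_nat_const big_mkcond [leqRHS]big_mkcond /=; apply: leq_sum => m _.
  by rewrite [m \in badm l]inE le /=; case: (m \in links e) => //=; case: ifP.
have : #|links e| <= #|goodm e| + \sum_(l : 'I_h) #|badm l|.
  rewrite -(cardsID (goodm e)) leq_add ?subset_leq_card ?subsetIr //.
  have -> : links e :\: goodm e = [set m | (m \in links e) && (m \notin goodm e)].
    by apply/setP => m; rewrite !inE andbC.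
  apply: leq_trans (union_bound (Q := fun m l => m \in badm l) _) _ => [m /andP[ml]|].
    rewrite [X in ~~ X]inE ml /= => /forallPn[l]; rewrite negb_imply -leqNgt => /andP[le ll].
    by exists l; rewrite inE ml le ll.
  by apply: leq_sum => l _; apply/subset_leq_card/subsetP => m; rewrite !inE => /andP[].
have : 2 * h * \sum_(l : 'I_h) #|badm l| <= h * #|links e|.
  rewrite big_distrr /= -[X in _ <= X * _](card_ord h) -sum_nat_const; exact: leq_sum.
have h0 : 0 < h by apply: leq_ltn_trans (ltn_ord k).
rewrite [2 * h]mulnC -mulnA leq_pmul2l //; rewrite -/e in large; lia.
Qed.

Lemma greedy_embedding : exists phi : label h -> V, injective phi /\
  forall (T : {set 'I_h}) k i, #|T| = 3 -> k \in T -> i \in T :\ k ->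
    g (phi (corner i)) (phi (midpoint (T :\ k))) (phi (apex T (T :\ k))) /\
    g (phi (corner i)) (phi (center T)) (phi (apex T (T :\ k))).
Proof.
have [P PE] : exists P, #|{: {set 'I_h}}| = P by eexists.
have LE : L = h + P + P + P * P by rewrite /L !card_sum card_prod card_ord !PE.
have imP (f : {set 'I_h} -> V) : #|[set f e | e : {set 'I_h}]| <= P by rewrite -PE leq_imset_card.
pose X1 := [set v i | i : 'I_h].
have X1h : #|X1| <= h by rewrite -[leqRHS](card_ord h) leq_imset_card.
(* The fallback [setT] lets the choice run over all sets of indices at once; for an edge of a 3-set,
   [card_goodm] shows that the first branch is taken. Centres and apexes are treated likewise. *)
have [m [m_inj mS]] : exists m : {set 'I_h} -> V, injective m /\ forall e,
    m e \in (if 2 * L <= #|goodm e| then goodm e else setT) /\ m e \notin X1.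
  apply: injective_choice => e; rewrite PE.
  case: ifP; rewrite ?cardsT; lia.
pose X2 := X1 :|: [set m e | e : {set 'I_h}].
have X2h : #|X2| <= h + P by apply: leq_trans (leq_card_setU _ _) _; rewrite leq_add.
pose goodc T := [set c in links T | [forall k in T, c \notin badc (T :\ k) T (m (T :\ k))]].
have [c [c_inj cS]] : exists c : {set 'I_h} -> V, injective c /\ forall T,
    c T \in (if L <= #|goodc T| then goodc T else setT) /\ c T \notin X2.
  apply: injective_choice => T; rewrite PE.
  case: ifP; rewrite ?cardsT; lia.
pose X3 := X2 :|: [set c e | e : {set 'I_h}].
have X3h : #|X3| <= h + P + P by apply: leq_trans (leq_card_setU _ _) _; rewrite leq_add.
pose S Te := if L <= #|fills Te.2 (m Te.2) (c Te.1)| then fills Te.2 (m Te.2) (c Te.1) else setT.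
have [w [w_inj wS]] : exists w : {set 'I_h} * {set 'I_h} -> V, injective w /\ forall Te,
    w Te \in S Te /\ w Te \notin X3.
  apply: injective_choice => Te; rewrite /S card_prod PE.
  case: ifP; rewrite ?cardsT; lia.
exists (fun l => match l with
  | inl (inl (inl i)) => v i | inl (inl (inr T)) => c T | inl (inr e) => m e | inr Te => w Te end).
split.
  have vm i e : v i <> m e.
    by move=> E; have [_] := mS e; rewrite -E imset_f.
  have vc i T : v i <> c T.
    by move=> E; have [_] := cS T; rewrite -E inE imset_f.
  have mc e T : m e <> c T.
    by move=> E; have [_] := cS T; rewrite -E inE orbC imset_f.
  have vw i Te : v i <> w Te.
    by move=> E; have [_] := wS Te; rewrite -E 2!inE imset_f.
  have mw e Te : m e <> w Te.
    by move=> E; have [_] := wS Te; rewrite -E 2!inE (imset_f m) // orbT.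
  have cw T Te : c T <> w Te.
    by move=> E; have [_] := wS Te; rewrite -E inE (imset_f c) // orbT.
  move=> [[[i|T]|e]|Te] [[[i'|T']|e']|Te'] E;
    try (by [case: (vm _ _ E)|case: (vc _ _ E)|case: (mc _ _ E)
            |case: (vw _ _ E)|case: (mw _ _ E)|case: (cw _ _ E)
            |case: (vm _ _ (esym E))|case: (vc _ _ (esym E))|case: (mc _ _ (esym E))
            |case: (vw _ _ (esym E))|case: (mw _ _ (esym E))|case: (cw _ _ (esym E))]).
  - by rewrite (v_inj E).
  - by rewrite (c_inj _ _ E).
  - by rewrite (m_inj _ _ E).
  - by rewrite (w_inj _ _ E).
move=> T k i T3 kT ik; rewrite /corner /midpoint /apex /center.
have mgood l : l \in T -> m (T :\ l) \in goodm (T :\ l).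
  by move=> lT; have [+ _] := mS (T :\ l); rewrite (card_goodm T3 lT).
(* At least a quarter of [links T], that is at least [L] vertices, is compatible with the three
   chosen midpoints. *)
have cgood : c T \in goodc T.
  have [+ _] := cS T; suff -> : L <= #|goodc T| by [].
  have [_ large] := links_large T3 kT.
  have : #|links T| <= #|goodc T| + \sum_(l in T) #|badc (T :\ l) T (m (T :\ l))|.
    rewrite -(cardsID (goodc T)) leq_add ?subset_leq_card ?subsetIr //.
    have -> : links T :\: goodc T = [set b | (b \in links T) && (b \notin goodc T)].
      by apply/setP => b; rewrite !inE andbC.
    pose Q b l := (l \in T) && (b \in badc (T :\ l) T (m (T :\ l))).
    apply: leq_trans (union_bound (Q := Q) _) _ => [b /andP[bl]|].
      rewrite [X in ~~ X]inE bl /= => /forallPn[l]; rewrite negb_imply negbK => /andP[lT lb].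
      by exists l; rewrite /Q lT.
    rewrite [leqRHS]big_mkcond; apply: leq_sum => l _; case: ifP => lT.
      by apply/subset_leq_card/subsetP => b; rewrite /Q !inE lT /= => /andP[].
    by rewrite (_ : [set _ | _] = set0) ?cards0 //; apply/setP => b; rewrite /Q !inE ?lT ?andbF.
  have : \sum_(l in T) 4 * #|badc (T :\ l) T (m (T :\ l))| <= \sum_(l in T) #|links T|.
    apply: leq_sum => l lT; have := mgood l lT; rewrite inE => /andP[_ /forallP/(_ l)].
    by rewrite setD11 /= setD1K // => /ltnW.
  rewrite -big_distrr sum_nat_const T3 /=; lia.
have [+ _] := wS (T, T :\ k); rewrite /S /=.
have : c T \notin badc (T :\ k) T (m (T :\ k)).
  by move: cgood; rewrite inE => /andP[_ /forall_inP]; apply.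
have cl : c T \in links T by move: cgood; rewrite inE => /andP[].
rewrite [X in ~~ X]inE cl /= -leqNgt => ->.
by rewrite inE => /forall_inP/(_ i ik)/andP[].
Qed.

End Greedy.

(** The number of labels [L] serves as the threshold [q]: with [L] fillers available, an apex can
    always avoid all other chosen vertices. *)
Lemma embed_subdivision (R : realFieldType) (h : nat) : (3 <= h)%N ->
  exists2 K : R, 1 <= K & forall (V : finType) (g : V -> V -> V -> bool) (D : R) (n := #|V|%:R : R),
    (0 < #|V|)%N -> 0 < D ->
    D * n ^+ 2 <= \sum_w \sum_b #|fiber g w b|%:R -> K * n ^+ 4 <= D ^+ 5 ->
    exists phi : label h -> V, injective phi /\
      forall (T : {set 'I_h}) k i, #|T| = 3%N -> k \in T -> i \in T :\ k ->
        g (phi (corner i)) (phi (midpoint (T :\ k))) (phi (apex T (T :\ k))) /\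
        g (phi (corner i)) (phi (center T)) (phi (apex T (T :\ k))).
Proof.
move=> h3; pose L := #|label h|.
have L0 : (0 < L)%N by apply/card_gt0P; exists (center set0).
pose K := (L * (8 * h) * (600 * h ^ 3) ^ 2)%N.
have h30 : (0 < h ^ 3)%N by rewrite expn_gt0; lia.
have K4 : (4 * L * (600 * h ^ 3) <= K)%N.
  rewrite /K; have : (4 * L * (600 * h ^ 3) <= L * (8 * h) * (600 * h ^ 3))%N.
    by rewrite leq_mul2r; apply/orP; right; nia.
  by move/leq_trans; apply; rewrite leq_mul2l; move: (h ^ 3)%N h30 => H; nia.
have K9 : (9 * h ^ 3 <= K)%N by apply: leq_trans K4; move: (h ^ 3)%N => H; nia.
have KL : (L <= K)%N by apply: leq_trans K4; move: (h ^ 3)%N h30 => H; nia.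
exists K%:R => [|V g D n V0 D0 HD HK]; first by rewrite ler1n; lia.
have n0 : 0 < n by rewrite ltr0n.
(* A fiber has at most [n] elements, so the average degree is at most [n]. With [K * n ^ 4 <= D ^ 5]
   this bounds [D], [D ^ 2 / n] and [D ^ 3 / n ^ 2] below by [K], hence [d2] and [d3] below by
   [4 * L]. *)
have Dn : D <= n.
  have : D * n ^+ 2 <= n * n ^+ 2.
    apply: le_trans HD _; have -> : n * n ^+ 2 = \sum_(w : V) \sum_(b : V) n.
      by rewrite !sumr_const -mulrnA -[RHS]mulr_natl natrM mulrC -expr2.
    by apply: ler_sum => w _; apply: ler_sum => b _; rewrite ler_nat max_card.
  by rewrite ler_pM2r // exprn_gt0.
have D2 : K%:R * n <= D ^+ 2.
  rewrite -(ler_pM2r (exprn_gt0 3 n0)) -mulrA -exprS; apply: le_trans HK _.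
  have -> : D ^+ 5 = D ^+ 2 * D ^+ 3 by rewrite -exprD.
  by rewrite ler_wpM2l ?lerXn2r ?nnegrE // ltW // exprn_gt0.
have D3 : K%:R * n ^+ 2 <= D ^+ 3.
  rewrite -(ler_pM2r (exprn_gt0 2 n0)) -mulrA -exprD; apply: le_trans HK _.
  have -> : D ^+ 5 = D ^+ 3 * D ^+ 2 by rewrite -exprD.
  by rewrite ler_wpM2l ?lerXn2r ?nnegrE // ltW // exprn_gt0.
have KD : K%:R <= D.
  rewrite -(ler_pM2r n0); apply: le_trans D2 _; by rewrite expr2 ler_wpM2l // ltW.
have [||w [b [U0 Ubad]]] := exists_good_fiber (h := h) (q := L) _ V0 D0 HD HK; first by lia.
  by apply: le_trans KD; rewrite ler_nat.
move: Ubad; set U := fiber g w b in U0 *.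
set d2 := D ^+ 2 / _; set d3 := D ^+ 3 / _ => Ubad.
have d2L : (4 * L)%:R <= d2.
  rewrite ler_pdivlMr ?mulr_gt0 ?ltr0n ?muln_gt0 ?expn_gt0 //; last by lia.
  by apply: le_trans D2; rewrite mulrA -natrM ler_wpM2r ?ler_nat // ltW.
have d3L : (4 * L)%:R <= d3.
  rewrite ler_pdivlMr ?mulr_gt0 ?exprn_gt0 ?ltr0n ?muln_gt0 ?expn_gt0 //; last by lia.
  by apply: le_trans D3; rewrite mulrA -natrM ler_wpM2r ?ler_nat // ?exprn_ge0 // ltW.
have [v [vU good]] := avoid_triples U0 Ubad.
have v_inj : injective v.
  move=> i j vij; apply/eqP; apply: contraT => ij.
  (* A third index, available since [h] is at least 3, completes [i, j] to a triple that would be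
     bad if [v i = v j]. *)
  have [k /andP[ik jk]] : exists k, (i != k) && (j != k).
    have : (0 < #|~: [set i; j]|)%N by rewrite cardsCs setCK cards2 card_ord ij subn_gt0; lia.
    by move=> /card_gt0P[k]; rewrite !inE negb_or ![k == _]eq_sym; exists k.
  by have := good i j k ij ik jk; rewrite /bad_triple /= vij eqxx.
have VL : (L <= #|V|)%N by rewrite -(ler_nat R) (le_trans _ Dn) // (le_trans _ KD) // ler_nat.
have facts (T : {set 'I_h}) k : #|T| = 3%N -> k \in T ->
    [/\ (4 * L <= #|links g w v (T :\ k)|)%N, (4 * L <= #|links g w v T|)%N &
     (8 * h * #|[set mc | [&& mc.1 \in links g w v (T :\ k), mc.2 \in links g w v T &
                #|fills g v (T :\ k) mc.1 mc.2| < L]]| <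
        #|links g w v (T :\ k)| * #|links g w v T|)%N].
  move=> T3 kT; have /eqP/cards2P[i [j [ij eE]]] : #|T :\ k| = 2%N.
    by have := cardsD1 k T; rewrite T3 kT /=; lia.
  have ik : i != k by have := setD11 k T; rewrite eE !inE => /norP[]; rewrite eq_sym.
  have jk : j != k by have := setD11 k T; rewrite eE !inE => /norP[_]; rewrite eq_sym.
  have l2 : links g w v (T :\ k) = link2 g w (v i) (v j).
    apply/setP => x; rewrite !inE eE; apply/forall_inP/andP => [H|[gi gj] l].
      by rewrite !H ?inE ?eqxx ?orbT.
    by rewrite !inE => /orP[]/eqP ->.
  have l3 : links g w v T = link3 g w (v i) (v j) (v k).
    apply/setP => x; rewrite !inE -(setD1K kT) eE; apply/forall_inP/and3P => [H|[gi gj gk] l].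
      by rewrite !H ?inE ?eqxx ?orbT.
    by rewrite !inE => /or3P[]/eqP ->.
  have fE m c : fills g v (T :\ k) m c = fillers g (v i) (v j) m c.
    apply/setP => x; rewrite !inE eE; apply/forall_inP/and4P => [H|[g1 g2 g3 g4] l].
      by have /andP[-> ->] := H i (set21 i j); have /andP[-> ->] := H j (set22 i j).
    by rewrite !inE => /orP[]/eqP ->; apply/andP.
  have := good i j k ij ik jk; rewrite /bad_triple /= !negb_or => /and4P[_ nl2 nl3].
  rewrite /heavy negb_and nl2 /= -ltnNge l2 l3 => lt.
  rewrite /low2 -leNgt in nl2; rewrite /low3 -leNgt in nl3.
  split; first by rewrite -(ler_nat R) (le_trans d2L).
    by rewrite -(ler_nat R) (le_trans d3L).
  apply: leq_ltn_trans lt; rewrite leq_mul2l; apply/orP; right.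
  by apply/subset_leq_card/subsetP => mc; rewrite !inE fE.
by apply: (greedy_embedding (w0 := w) v_inj VL) => T k T3 kT; have [] := facts T k T3 kT.
Qed.

(** * Homeomorphisms *)

From mathcomp Require Import all_classical all_reals all_analysis.
Import numFieldNormedType.Exports.

(** Continuity tested on all continuous families [u]: this needs no topology on [V -> R] and makes
    composition immediate. *)
Definition coordwise_continuous (R : realType) (V W : finType) (f : (V -> R) -> W -> R) : Prop :=
  forall (X : topologicalType) (u : X -> V -> R),
    (forall v, continuous (fun x => u x v : R^o)) ->
    forall w, continuous (fun x => f (u x) w : R^o).

Definition coord_homeo (R : realType) (V W : finType) (K : {set {set V}}) (L : {set {set W}}) :=
  exists (f : (V -> R) -> W -> R) (g : (W -> R) -> V -> R),
    [/\ coordwise_continuous f /\ coordwise_continuous g,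
        forall x, polyhedron K x -> polyhedron L (f x),
        forall y, polyhedron L y -> polyhedron K (g y),
        forall x, polyhedron K x -> g (f x) = x &
        forall y, polyhedron L y -> f (g y) = y].

Lemma coord_homeo_trans (R : realType) (V W Z : finType)
    (K : {set {set V}}) (L : {set {set W}}) (M : {set {set Z}}) :
  coord_homeo R K L -> coord_homeo R L M -> coord_homeo R K M.
Proof.
move=> [f [g [[fc gc] fK gK gf fg]]] [f' [g' [[fc' gc'] fK' gK' gf' fg']]].
exists (f' \o f), (g \o g'); split.
- split=> X u uc; [exact: (fc' _ _ (fc _ _ uc))|exact: (gc _ _ (gc' _ _ uc))].
- by move=> x /fK /fK'.
- by move=> y /gK' /gK.
- by move=> x xK /=; rewrite gf' ?gf //; exact: fK.
- by move=> y yM /=; rewrite fg ?fg' //; exact: gK'.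
Qed.

Lemma continuous_sumr (R : realType) (X : topologicalType) (I : Type) (r : seq I) (P : pred I)
    (F : I -> X -> R) :
  (forall i, continuous (F i : X -> R^o)) ->
  continuous ((fun x => \sum_(i <- r | P i) F i x) : X -> R^o).
Proof.
move=> Fc x; elim: r => [|i r IH].
  by under eq_fun do rewrite big_nil; exact: cvg_cst.
under eq_fun do rewrite big_cons.
by case: (P i) => //; apply: (cvgD (Fc i x) IH).
Qed.

Lemma continuous_min_on (R : realType) (X : topologicalType) (V : finType) (s : {set V})
    (u : X -> V -> R) :
  (forall v, continuous (fun x => u x v : R^o)) ->
  continuous ((fun x => min_on s (u x)) : X -> R^o).
Proof.
move=> uc x; rewrite /min_on; elim: (index_enum V) => [|i r IH].
  by under eq_fun do rewrite big_nil; exact: cvg_cst.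
under eq_fun do rewrite big_cons.
by case: (i \in s) => //; apply: (continuous_min (uc i x) IH).
Qed.

Lemma star_continuous (R : realType) (V J : finType) (P : {pred J}) (s : J -> {set V}) :
  coordwise_continuous (@star R V J P s).
Proof.
move=> X u uc [i|j] x /=.
  apply: (@cvgB _ R^o); first exact: uc.
  by apply: continuous_sumr => j; exact: continuous_min_on.
case: (j \in P); last exact: cvg_cst.
by apply: cvgM; [exact: cvg_cst|exact: continuous_min_on].
Qed.

Lemma unstar_continuous (R : realType) (V J : finType) (P : {pred J}) (s : J -> {set V}) :
  coordwise_continuous (@unstar R V J P s).
Proof.
move=> X u uc i x; apply: (@cvgD _ R^o); first exact: uc.
apply: continuous_sumr => j {}x; apply: cvgM; [exact: uc|exact: cvg_cst].
Qed.

Lemma star_homeo (R : realType) (V J : finType) (P : {pred J}) (s : J -> {set V})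
    (K : {set {set V}}) :
  (forall j, j \in P -> s j != finset.set0) ->
  (forall A, A \in K -> exists2 j, j \in P & s j \subset A) ->
  (forall A j j', A \in K -> j \in P -> j' \in P ->
     s j \subset A -> s j' \subset A -> j = j') ->
  coord_homeo R K (star_complex P s K).
Proof.
move=> s0 sK sU; exists (star P s), (unstar P s); split.
- split; [exact: star_continuous|exact: unstar_continuous].
- by move=> x; exact: star_polyhedron.
- by move=> y; exact: unstar_polyhedron.
- by move=> x _; apply/funext; exact: starK.
- by move=> y yK; apply/funext; exact: (unstarK s0 sU).
Qed.

(** Coordinates are pushed forward by summing over the fibres of [phi] and pulled back by
    composition. Outside the image of [phi] all points of the target vanish. *)
Lemma relabel_homeo (R : realType) (V W : finType) (phi : V -> W) (K : {set {set V}}) :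
  injective phi -> coord_homeo R K [set phi @: A | A : {set V} in K]%SET.
Proof.
move=> phi_inj.
pose f (x : V -> R) w := \sum_(v | phi v == w) x v.
pose g (y : W -> R) v := y (phi v).
have fphi x v : f x (phi v) = x v.
  by rewrite /f (eq_bigl (pred1 v)) ?big_pred1_eq // => v'; rewrite (inj_eq phi_inj).
have supp (y : W -> R) (A : {set V}) w : (forall w, w \notin (phi @: A)%SET -> y w = 0) ->
    (forall v, phi v != w) -> y w = 0.
  move=> yA pw; apply: yA; apply/imsetP => -[v _ wv]; by move: (pw v); rewrite wv eqxx.
have sumf (x : V -> R) : \sum_w f x w = \sum_v x v.
  by rewrite /f (partition_big phi predT).
exists f, g; split.
- split=> X u uc w; first exact: continuous_sumr.
  exact: uc.
- move=> x [x0 [xS [A KA xA]]]; split; first by move=> w; exact: sumr_ge0.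
  split; first by rewrite sumf.
  exists (phi @: A)%SET; first by apply/imsetP; exists A.
  move=> w wA; rewrite /f big1 // => v /eqP vw; apply: xA; apply: contra wA.
  by rewrite -vw; exact: imset_f.
- move=> y [y0 [yS [_ /imsetP[A KA ->] yA]]]; split; first by move=> v; exact: y0.
  split.
    rewrite -yS (partition_big phi predT) //=; apply: eq_bigr => w _.
    have [v vw|nw] := pickP (fun v => phi v == w).
      rewrite -(eqP vw) (eq_bigl (pred1 v)) ?big_pred1_eq // => v'.
      by rewrite (inj_eq phi_inj).
    rewrite big_pred0 // (supp y A) // => v; by rewrite nw.
  exists A => // v vA; apply: yA; apply: contra vA => /imsetP[v' v'A /phi_inj ->] //.
- by move=> x _; apply/funext => v; exact: fphi.
- move=> y [_ [_ [_ /imsetP[A KA ->] yA]]]; apply/funext => w.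
  have [v /eqP <-|nw] := pickP (fun v => phi v == w); first exact: fphi.
  rewrite /f big_pred0 // (supp y A) // => v; by rewrite nw.
Qed.

Lemma continuous_rowP (R : realType) (X : topologicalType) (n : nat) (f : X -> 'rV[R]_n) :
  (forall i, continuous (fun x => f x ord0 i : R^o)) -> continuous f.
Proof.
move=> fc x; apply/cvg_ballP => e e0; near=> y; split=> // i j.
rewrite (ord1 i); move: j; near: y; apply: filter_forall => j.
by have /cvg_ballP := fc j x; exact.
Unshelve. all: by end_near. Qed.

Lemma coord_homeo_realization (R : realType) (m n : nat) (K : {set {set 'I_m}})
    (L : {set {set 'I_n}}) :
  coord_homeo R K L -> homeomorphic_sets (@realization R m K) (@realization R n L).
Proof.
move=> [f [g [[fc gc] fK gK gf fg]]].
pose vec k (x : 'I_k -> R) : 'rV[R]_k := \row_i x i.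
pose crd k (x : 'rV[R]_k) : 'I_k -> R := x ord0.
have crdK k : cancel (@crd k) (@vec k) by move=> x; apply/rowP => i; rewrite mxE.
have vecK k : cancel (@vec k) (@crd k) by move=> x; apply/funext => i; rewrite /crd mxE.
have crdc k i : continuous (fun x : 'rV[R]_k => crd k x i : R^o) by exact: coord_continuous.
have realE k (M : {set {set 'I_k}}) x : realization M x = polyhedron M (crd k x) by [].
exists (fun x => vec n (f (crd m x))), (fun y => vec m (g (crd n y))).
split; [|split; [|split; [|split; [|split]]]].
- apply: continuous_subspaceT; apply: continuous_rowP => i.
  by under eq_fun do rewrite mxE; exact: (fc _ _ (crdc m)).
- apply: continuous_subspaceT; apply: continuous_rowP => i.
  by under eq_fun do rewrite mxE; exact: (gc _ _ (crdc n)).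
- by move=> x; rewrite !realE vecK; exact: fK.
- by move=> y; rewrite !realE vecK; exact: gK.
- by move=> x; rewrite realE => xK; rewrite vecK gf ?crdK.
- by move=> y; rewrite realE => yL; rewrite vecK fg ?crdK.
Qed.

(** Each round requires that a facet contain exactly one starred simplex: first the face itself,
    then its edge opposite [k], then the segment from its centre to its midpoint. *)
Lemma subdivision_homeo (R : realType) (h : nat) (H : {set {set 'I_h}}) :
  uniform3 H -> coord_homeo R H (subdivision H).
Proof.
move=> H3; rewrite /subdivision.
set K2 := (X in star_complex _ _ X); set K1 := (X in star_complex _ _ X) in K2 *.
apply: (@coord_homeo_trans _ _ _ _ _ K1); last apply: (@coord_homeo_trans _ _ _ _ _ K2).
- apply: star_homeo => [T /H3 T3|A AH|A T T' AH TH T'H].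
  + by rewrite -cards_eq0 T3.
  + by exists A.
  + move=> TA T'A; have AE B : B \in H -> B \subset A -> B = A.
      by move=> BH BA; apply/eqP; rewrite eqEcard BA !H3.
    by rewrite (AE T) // (AE T').
- apply: star_homeo => [e|A|A e e'].
  + rewrite inE => /eqP e2; rewrite -cards_eq0 card_imset ?e2 // => ? ? [] //.
  + move=> /(centered_facet H3)[T [k [TH kT ->]]]; exists (T :\ k)%SET.
      by rewrite inE (card_face H3).
    exact: finset.subsetUr.
  + move=> /(centered_facet H3)[T [k [TH kT ->]]]; rewrite !inE => /eqP e2 /eqP e2'.
    by move=> /(centered_facet_edge H3 TH kT e2) -> /(centered_facet_edge H3 TH kT e2') ->.
- apply: star_homeo => [[T e] _|A|A [T1 e1] [T2 e2]].
  + by apply/finset.set0Pn; exists (inr e); rewrite !inE eqxx orbT.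
  + move=> /(bisected_facet H3)[T [k [i [TH kT ik ->]]]]; exists (T, (T :\ k)%SET) => //.
    by apply/fintype.subsetP => x; rewrite !inE => /orP[]/eqP ->; rewrite eqxx ?orbT.
  + move=> /(bisected_facet H3)[T [k [i [TH kT ik ->]]]] _ _.
    move=> /fintype.subsetP s1 /fintype.subsetP s2.
    have := s1 (inl (inr T1)); rewrite !inE eqxx /= orbF => /(_ isT)/eqP[->].
    have := s1 (inr e1); rewrite !inE eqxx orbT !orbF => /(_ isT)/eqP[->].
    have := s2 (inl (inr T2)); rewrite !inE eqxx /= orbF => /(_ isT)/eqP[->].
    by have := s2 (inr e2); rewrite !inE eqxx orbT !orbF => /(_ isT)/eqP[->].
Qed.

(** * From edge density to the homeomorph *)

Lemma card_le_fibers (n : nat) (G : {set {set 'I_n}}) : uniform3 G ->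
  (#|G| <= \sum_w \sum_b #|fiber (fun v b w => [set v; b; w]%SET \in G) w b|)%N.
Proof.
move=> G3.
pose S := [set t : 'I_n * 'I_n * 'I_n | [set t.2; t.1.2; t.1.1]%SET \in G]%SET.
have -> : (\sum_w \sum_b #|fiber (fun v b w => [set v; b; w]%SET \in G) w b| = #|S|)%N.
  rewrite pair_bigA card_sum_bool.
  rewrite -(pair_bigA _ (fun wb v => ([set v; wb.2; wb.1]%SET \in G) : nat)) /=.
  by apply: eq_bigr => wb _; rewrite card_sum_bool.
(* The double sum counts ordered triples, and every edge comes from at least one of them. *)
suff /fintype.subset_leq_card/leq_trans : G \subset [set [set t.2; t.1.2; t.1.1]%SET | t in S]%SET.
  by apply; exact: leq_imset_card.
apply/fintype.subsetP => e eG; have e3 := G3 e eG.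
have [x xe] : exists x, x \in e by apply/card_gt0P; rewrite e3.
have /eqP/cards2P[y [z [_ yz]]] : #|(e :\ x)%SET| = 2%N.
  by have := cardsD1 x e; rewrite e3 xe => -[].
have eE : e = [set x; y; z]%SET by rewrite -(finset.setD1K xe) yz finset.setUA.
by apply/imsetP; exists (z, y, x); rewrite ?inE -?eE.
Qed.

Theorem theorem1p1 (R : realType) (h : nat) (H : {set {set 'I_h}}) :
  uniform3 H ->
  exists C : R, 0 < C /\
    forall (n : nat) (G : {set {set 'I_n}}),
      uniform3 G -> (0 < n)%N ->
      C * (n%:R `^ (3 - 5^-1)) <= #|G|%:R ->
      contains_homeomorph R G H.
Proof.
(* An empty H has an empty realization, matched by the empty subgraph. Otherwise a face provides
   [h >= 3]. *)
move=> H3; have [->|/finset.set0Pn[T0 T0H]] := eqVneq H finset.set0.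
  exists 1; split=> // n G _ _ _; exists finset.set0; first exact: finset.sub0set.
  have empty k (x : 'rV[R]_k) : ~ realization finset.set0 x.
    by move=> [_ [_ [e]]]; rewrite inE.
  exists (fun=> 0), (fun=> 0).
  split; first by apply: continuous_subspaceT; exact: cst_continuous.
  split; first by apply: continuous_subspaceT; exact: cst_continuous.
  by split; [|split; [|split]] => x /empty.
have h3 : (3 <= h)%N by have := max_card (mem T0); rewrite (H3 _ T0H) card_ord.
have [K K1 emb] := embed_subdivision R h3.
exists K; split=> [|n G G3 n0 KG]; first by rewrite (lt_le_trans _ K1).
pose g (v b w : 'I_n) := [set v; b; w]%SET \in G.
(* With this [D], [D * N ^ 2] equals [K * N ^ (3 - 1/5)], the assumed number of edges, and
   [D ^ 5 = K ^ 5 * N ^ 4] is at least [K * N ^ 4] because [K >= 1]. *)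
pose N : R := n%:R; pose D := K * N `^ (4 / 5).
have N0 : 0 < N by rewrite ltr0n.
have K0 : 0 < K by apply: lt_le_trans K1.
have D0 : 0 < D by rewrite mulr_gt0 ?powR_gt0.
have [|||phi [phi_inj phiG]] := emb _ g D _ D0.
- by rewrite card_ord.
- rewrite card_ord -/N; apply: (@le_trans _ _ #|G|%:R).
    apply: le_trans KG; rewrite /D -mulrA -powR_mulrn ?ler0n // -powRD; last first.
      by rewrite gt_eqF ?implybT // ltr0n.
    by rewrite (_ : 4 / 5 + 2%:R = 3 - 5^-1) //; field.
  under eq_bigr do rewrite -natr_sum.
  by rewrite -natr_sum ler_nat; exact: card_le_fibers.
- rewrite card_ord -/N /D exprMn -(powR_mulrn 5 (powR_ge0 N (4 / 5))) -powRrM.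
  rewrite (_ : 4 / 5 * 5%:R = 4%:R :> R); last by field.
  rewrite powR_mulrn ?ler0n // ler_pM2r ?exprn_gt0 //.
  by rewrite exprS ler_peMr ?exprn_ege1 // ltW.
exists [set phi @: A | A : {set label h} in subdivision H]%SET.
  apply/fintype.subsetP => _ /imsetP[B /(subdivision_facet H3) + ->].
  move=> [T [k [i [b [[TH kT ik bE] ->]]]]].
  have [gm gc] := phiG T k i (H3 T TH) kT ik.
  have -> : (phi @: [set apex T (T :\ k); corner i; b] =
      [set phi (corner i); phi b; phi (apex T (T :\ k))])%SET.
    by rewrite !imsetU !imset_set1 -finset.setUA finset.setUC.
  by case: bE => ->.
apply: coord_homeo_realization; apply: coord_homeo_trans (relabel_homeo _ _ phi_inj).
exact: subdivision_homeo.
Qed.
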